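(* Let $f:[\theta_1,\theta_2]\to\mathbb{R}$ be a differentiable function on $(\theta_1,\theta_2)$ with $\theta_1<\theta_2$ and $f'\in L_1[\theta_1,\theta_2]$. If $|f'|^q$ is a convex function, then the following inequality for Atangana-Baleanu fractional integral operators holds: $$\Bigg|\frac{2(\theta_2-\theta_1)^{\alpha}+(1-\alpha)2^{\alpha+1}\Gamma(\alpha)}{(\theta_2-\theta_1)^{\alpha+1}}\left[f(\theta_1)+f(\theta_2)+2f\left(\tfrac{\theta_1+\theta_2}{2}\right)\right]$$ $$-\frac{2^{\alpha+1}B(\alpha)\Gamma(\alpha)}{(\theta_2-\theta_1)^{\alpha+1}}\left[\left({}^{AB}I^{\alpha}_{\frac{\theta_1+\theta_2}{2}}f\right)(\theta_1)+\left({}^{AB}_{\theta_1}I^{\alpha}f\right)\left(\tfrac{\theta_1+\theta_2}{2}\right)+\left({}^{AB}_{\frac{\theta_1+\theta_2}{2}}I^{\alpha}f\right)(\theta_2)+\left({}^{AB}I^{\alpha}_{\theta_2}f\right)\left(\tfrac{\theta_1+\theta_2}{2}\right)\right]\Bigg|$$ $$\le\frac{2}{(\alpha p+1)^{1/p}}\left[\left(\frac{3|f'(\theta_1)|^q+|f'(\theta_2)|^q}{4}\right)^{1/q}+\left(\frac{3|f'(\theta_2)|^q+|f'(\theta_1)|^q}{4}\right)^{1/q}\right],$$ where $p^{-1}+q^{-1}=1$, $\alpha\in[0,1]$, $q>1$ and $B(\alpha)$ is a normalization function.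
   Context: $\Gamma$ is the Gamma function and $B(\alpha)$ is the normalization function appearing in the Atangana-Baleanu operators. The left and right Atangana-Baleanu fractional integrals of order $\alpha\in[0,1]$ with base points $a$ and $b$ are, respectively, $$\left({}^{AB}_{a}I^{\alpha}f\right)(t)=\frac{1-\alpha}{B(\alpha)}f(t)+\frac{\alpha}{B(\alpha)\Gamma(\alpha)}\int_a^t f(y)(t-y)^{\alpha-1}\,dy,$$ $$\left({}^{AB}I^{\alpha}_{b}f\right)(t)=\frac{1-\alpha}{B(\alpha)}f(t)+\frac{\alpha}{B(\alpha)\Gamma(\alpha)}\int_t^b f(y)(y-t)^{\alpha-1}\,dy.$$
   Formalization: The value α = 0 is excluded, since Γ(0) is undefined, and f is assumed continuous at θ1 and θ2 (automatic if f'(θ1), f'(θ2) are one-sided derivatives; the claim fails without it). *)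

(* Defs.v *)
From HB Require Import structures.
From mathcomp Require Import all_boot all_order all_algebra.
From mathcomp Require Import all_classical all_reals all_analysis.
Import Order.TTheory GRing.Theory Num.Theory.
Import numFieldNormedType.Exports.

Set Implicit Arguments.
Unset Strict Implicit.
Unset Printing Implicit Defensive.

Local Open Scope classical_set_scope.
Local Open Scope ring_scope.

(* Euler's integral; this is the Gamma function only for 0 < x. For x <= 0 the
   integral diverges and Rintegral returns 0. *)
Definition Gamma (R : realType) (x : R) : R :=
  \int[@lebesgue_measure R]_(t in `]0, +oo[) (t `^ (x - 1) * expR (- t)).

(* The standard requirements on the function B of the Atangana-Baleanu
   operators. *)
Definition normalization_function (R : realType) (B : R -> R) : Prop :=
  [/\ B 0 = 1, B 1 = 1 & forall a, 0 <= a <= 1 -> 0 < B a].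

Definition AB_left_integral (R : realType) (B : R -> R) (a alpha : R)
    (f : R -> R) (t : R) : R :=
  (1 - alpha) / B alpha * f t +
  alpha / (B alpha * Gamma alpha) *
    \int[@lebesgue_measure R]_(y in `[a, t]) (f y * (t - y) `^ (alpha - 1)).

Definition AB_right_integral (R : realType) (B : R -> R) (b alpha : R)
    (f : R -> R) (t : R) : R :=
  (1 - alpha) / B alpha * f t +
  alpha / (B alpha * Gamma alpha) *
    \int[@lebesgue_measure R]_(y in `[t, b]) (f y * (y - t) `^ (alpha - 1)).

(* df represents f' on [a, b]: f is differentiable with derivative df on the
   open interval and continuous up to the endpoints, while df a and df b are
   left free. If f has one-sided derivatives at a and b (or is differentiable on
   a larger open interval), then f is continuous there and df a and df b can be
   taken to be these derivatives. *)
Definition is_derivative_itv (R : realType) (f df : R -> R) (a b : R) : Prop :=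
  derivable_oo_LRcontinuous f a b /\
  {in `]a, b[, forall x, derive1 f x = df x}.

(* Main.v *)
Require Import Defs.
From HB Require Import structures.
From mathcomp Require Import all_boot all_order all_algebra.
From mathcomp Require Import all_classical all_reals all_analysis.
From mathcomp Require Import measurable_realfun.
From mathcomp Require Import ring lra.
Import Order.TTheory GRing.Theory Num.Theory.
Import numFieldNormedType.Exports.

Set Implicit Arguments.
Unset Strict Implicit.
Unset Printing Implicit Defensive.

Local Open Scope classical_set_scope.
Local Open Scope ring_scope.

(** ** Idea of the proof

With [h = (theta2 - theta1) / 2], each of the four fractional integrals lives
on one half of the interval.  The local terms [(1 - alpha) / B alpha * f] cancel
on the left-hand side, and what remains is [1 / h ^ (alpha + 1)] times a sum of
four quantities of the shape
[[
  f(e) * h ^ alpha - alpha * \int_x^y f(t) * |t - s| ^ (alpha - 1) dt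
]]
where [[x, y]] is one of the halves, [s] one of its endpoints and [e] the other
one.  An integration by parts turns each of them into
[\int f'(t) * W(t) dt] with [|W(t)| = |t - s| ^ alpha], and Hoelder's
inequality bounds it by
[(\int |f'| ^ q) ^ (1 / q) * (\int |W| ^ p) ^ (1 / p)].  Convexity bounds
[|f'| ^ q] by its chord, whose mean over the left half is [(3 c1 + c2) / 4] and
over the right half [(3 c2 + c1) / 4], where [c1] and [c2] are the values of
[|f'| ^ q] at the endpoints.

The derivative [f'] is not known to be continuous, so the integration by parts
cannot rely on the fundamental theorem of calculus for [f'].  The integral of
[f' W] is avoided altogether: the function
[D(t) = f(t) W(t) - \int_x^t f W'] is continuous and has derivative [f' W],
because [f W'] is continuous inside the interval.  Hoelder's inequality is then
used in a differential form ([norm_increment_holder]): if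
[|D'| <= (P') ^ (1 / q) * (Q') ^ (1 / p)], then the same bound holds for the
increments of [D], [P] and [Q].  It follows from Young's inequality and the
mean value theorem.  Here [P] and [Q] are explicit primitives of the chord
and of [|W| ^ p].

Since [W'] is unbounded at [s] when [alpha < 1], its integrability is a separate point
([integrable_nonneg_derivative]); it also gives the convergence of Euler's
integral at 0.  Positivity of [Gamma alpha] ([Gamma_gt0]) is needed because the
statement multiplies by [Gamma alpha] and divides by it. *)

(** * Hoelder's inequality for increments *)

(** Optimisation over [s] of the weighted Young bound: the infimum of the
    right-hand side over [s > 0] is the Hoelder product.  If exactly one of
    [X] and [Y] vanishes, it is only approached, as [s] tends to 0 or to
    infinity. *)
Lemma le_powR_of_le_scaled (R : realType) (z X Y p q : R) :
  0 < p -> 0 < q -> p^-1 + q^-1 = 1 -> 0 <= X -> 0 <= Y ->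
  (forall s, 0 < s -> z <= s * X / q + s `^ (- (p / q)) * Y / p) ->
  z <= X `^ q^-1 * Y `^ p^-1.
Proof.
move=> p0 q0 pq X0 Y0 zle.
have pn : p != 0 by rewrite gt_eqF.
have qn : q != 0 by rewrite gt_eqF.
have pqV0 : 0 < p / q by rewrite divr_gt0.
have [X00|Xn0] := eqVneq X 0; have [Y00|Yn0] := eqVneq Y 0.
- have := zle 1 ltr01; rewrite X00 Y00 !mulr0 !mul0r addr0.
  by rewrite powR0 ?mul0r// invr_eq0.
- rewrite X00 powR0 ?invr_eq0// mul0r; apply/ler_addgt0Pr => e e0.
  rewrite add0r.
  have Ygt0 : 0 < Y by rewrite lt_neqAle eq_sym Yn0.
  have epY : 0 < e * p / Y by rewrite divr_gt0// mulr_gt0.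
  have := zle ((e * p / Y) `^ (- (q / p))) (powR_gt0 _ epY).
  rewrite X00 mulr0 mul0r add0r -powRrM mulrNN.
  rewrite (_ : q / p * (p / q) = 1); last by field; rewrite pn qn.
  rewrite powRr1 ?(ltW epY)// (_ : e * p / Y * Y / p = e)//.
  by field; rewrite pn Yn0.
- rewrite Y00 powR0 ?invr_eq0// mulr0; apply/ler_addgt0Pr => e e0.
  rewrite add0r.
  have Xgt0 : 0 < X by rewrite lt_neqAle eq_sym Xn0.
  have eqX : 0 < e * q / X by rewrite divr_gt0// mulr_gt0.
  have := zle _ eqX; rewrite Y00 mulr0 mul0r addr0.
  by rewrite (_ : e * q / X * X / q = e)//; field; rewrite qn Xn0.
have Xgt0 : 0 < X by rewrite lt_neqAle eq_sym Xn0.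
have Ygt0 : 0 < Y by rewrite lt_neqAle eq_sym Yn0.
have YX0 : 0 < Y / X by rewrite divr_gt0.
(* the value of s for which s * X = s ^ (- p / q) * Y *)
have := zle ((Y / X) `^ p^-1) (powR_gt0 _ YX0).
have -> : (Y / X) `^ p^-1 * X = X `^ q^-1 * Y `^ p^-1.
  rewrite powRM ?(ltW Ygt0) ?invr_ge0 ?(ltW Xgt0)//.
  rewrite -[X^-1]powR_inv1 ?(ltW Xgt0)// -powRrM mulN1r.
  rewrite -mulrA -[X in _ * (_ * X)]powRr1 ?(ltW Xgt0)// -powRD ?Xn0 ?implybT//.
  by rewrite mulrC; congr (_ `^ _ * _); lra.
have -> : (Y / X) `^ p^-1 `^ (- (p / q)) * Y = X `^ q^-1 * Y `^ p^-1.
  rewrite -powRrM (_ : p^-1 * - (p / q) = - q^-1); last by field; rewrite pn qn.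
  rewrite powRM ?(ltW Ygt0) ?invr_ge0 ?(ltW Xgt0)//.
  rewrite -[X^-1]powR_inv1 ?(ltW Xgt0)// -powRrM mulN1r opprK.
  rewrite mulrAC -[X in _ * X * _]powRr1 ?(ltW Ygt0)// -powRD ?Yn0 ?implybT//.
  by rewrite mulrC; congr (_ * _ `^ _); lra.
by rewrite -mulrDr addrC pq mulr1.
Qed.

(** Mean value theorem for [E - D]. *)
Lemma le_increment_of_le_derive (R : realType) (D E d e : R -> R) (x y : R) :
  x < y ->
  {within `[x, y], continuous D} -> {within `[x, y], continuous E} ->
  (forall t, t \in `]x, y[ -> is_derive t 1 D (d t)) ->
  (forall t, t \in `]x, y[ -> is_derive t 1 E (e t)) ->
  (forall t, t \in `]x, y[ -> d t <= e t) ->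
  D y - D x <= E y - E x.
Proof.
move=> xy cD cE dD dE de.
have dED t : t \in `]x, y[ -> is_derive t 1 (E \- D) ((e \- d) t).
  by move=> tI; apply: is_deriveB; [exact: dE|exact: dD].
have cED : {within `[x, y], continuous (E \- D)}.
  by move=> t; apply: continuousB; [exact: cE|exact: cD].
have [t tI EDE] := MVT xy dED cED.
have : 0 <= (e \- d) t * (y - x).
  by rewrite mulr_ge0 ?subr_ge0 ?(ltW xy)//; exact: de.
by rewrite -EDE /=; lra.
Qed.

(** For every [s > 0], Young's inequality bounds [d] by the derivative of
    [s / q * P + s ^ (- p / q) / p * Q]; the increments are compared by the
    mean value theorem and [s] is optimised afterwards. *)
Lemma le_increment_holder (R : realType) (D P Q d u v : R -> R) (x y p q : R) :
  x < y -> 0 < p -> 0 < q -> p^-1 + q^-1 = 1 ->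
  {within `[x, y], continuous D} ->
  {within `[x, y], continuous P} -> {within `[x, y], continuous Q} ->
  (forall t, t \in `]x, y[ -> is_derive t 1 D (d t)) ->
  (forall t, t \in `]x, y[ -> is_derive t 1 P (u t)) ->
  (forall t, t \in `]x, y[ -> is_derive t 1 Q (v t)) ->
  (forall t, t \in `]x, y[ -> 0 <= u t) ->
  (forall t, t \in `]x, y[ -> 0 <= v t) ->
  (forall t, t \in `]x, y[ -> d t <= u t `^ q^-1 * v t `^ p^-1) ->
  D y - D x <= (P y - P x) `^ q^-1 * (Q y - Q x) `^ p^-1.
Proof.
move=> xy p0 q0 pq cD cP cQ dD dP dQ u0 v0 duv.
have pn : p != 0 by rewrite gt_eqF.
have qn : q != 0 by rewrite gt_eqF.
have incr (F f : R -> R) : {within `[x, y], continuous F} ->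
    (forall t, t \in `]x, y[ -> is_derive t 1 F (f t)) ->
    (forall t, t \in `]x, y[ -> 0 <= f t) -> 0 <= F y - F x.
  move=> cF dF f0.
  have c0 : {within `[x, y], continuous (cst 0 : R -> R)}.
    by move=> ?; exact: cst_continuous.
  have d0 t : t \in `]x, y[ ->
      is_derive t 1 (cst 0 : R -> R) ((cst 0 : R -> R) t).
    by move=> _; exact: is_derive_cst.
  by have := le_increment_of_le_derive xy c0 cF d0 dF f0; rewrite subr0.
apply: le_powR_of_le_scaled => //; first exact: incr dP _.
  exact: incr dQ _.
move=> s s0; pose c := s `^ (- (p / q)).
have c0 : 0 < c by exact: powR_gt0.
have := @le_increment_of_le_derive _ D ((s / q) \*: P \+ (c / p) \*: Q) d
  (fun t => s / q * u t + c / p * v t) x y xy cD.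
have -> : s * (P y - P x) / q + c * (Q y - Q x) / p =
  ((s / q) \*: P \+ (c / p) \*: Q) y - ((s / q) \*: P \+ (c / p) \*: Q) x.
  rewrite /= /GRing.scale/=; field; by rewrite pn qn.
apply=> //.
- move=> t; apply: continuousD.
    by apply: continuousM; [exact: cst_continuous|exact: cP].
  by apply: continuousM; [exact: cst_continuous|exact: cQ].
- move=> t tI; apply: is_deriveD; apply: is_deriveZ; [exact: dP|exact: dQ].
move=> t tI; apply: (le_trans (duv _ tI)).
have ut := u0 _ tI; have vt := v0 _ tI.
(* the two powers of s cancel, as c ^ (1 / p) = s ^ (- 1 / q) *)
have -> : u t `^ q^-1 * v t `^ p^-1 = (s * u t) `^ q^-1 * (c * v t) `^ p^-1.
  rewrite !powRM ?(ltW s0) ?(ltW c0)// mulrACA /c -powRrM.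
  rewrite (_ : - (p / q) * p^-1 = - q^-1); last by field; rewrite pn qn.
  by rewrite powRN divff ?mul1r// gt_eqF// powR_gt0.
have := @conjugate_powR _ ((s * u t) `^ q^-1) ((c * v t) `^ p^-1) q p
  (powR_ge0 _ _) (powR_ge0 _ _) q0 p0 _.
rewrite -!powRrM !mulVf// !powRr1 ?mulr_ge0 ?(ltW s0) ?(ltW c0)//.
rewrite addrC pq => /(_ erefl)/le_trans; apply.
by rewrite le_eqVlt; apply/orP; left; apply/eqP; field; rewrite pn qn.
Qed.

Lemma norm_increment_holder (R : realType) (D P Q d u v : R -> R)
    (x y p q : R) :
  x < y -> 0 < p -> 0 < q -> p^-1 + q^-1 = 1 ->
  {within `[x, y], continuous D} ->
  {within `[x, y], continuous P} -> {within `[x, y], continuous Q} ->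
  (forall t, t \in `]x, y[ -> is_derive t 1 D (d t)) ->
  (forall t, t \in `]x, y[ -> is_derive t 1 P (u t)) ->
  (forall t, t \in `]x, y[ -> is_derive t 1 Q (v t)) ->
  (forall t, t \in `]x, y[ -> 0 <= u t) ->
  (forall t, t \in `]x, y[ -> 0 <= v t) ->
  (forall t, t \in `]x, y[ -> `|d t| <= u t `^ q^-1 * v t `^ p^-1) ->
  `|D y - D x| <= (P y - P x) `^ q^-1 * (Q y - Q x) `^ p^-1.
Proof.
move=> xy p0 q0 pq cD cP cQ dD dP dQ u0 v0 duv.
rewrite ler_norml; apply/andP; split; last first.
  apply: (le_increment_holder xy p0 q0 pq cD cP cQ dD dP dQ u0 v0) => t tI.
  exact: le_trans (ler_norm _) (duv _ tI).
rewrite lerNl opprB addrC -[D x]opprK.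
apply: (@le_increment_holder _ (\- D) P Q (\- d) u v) => //.
- by move=> t; apply: continuousN; exact: cD.
- by move=> t tI; apply: is_deriveN; exact: dD.
- by move=> t tI; rewrite (le_trans (ler_norm _))//= normrN; exact: duv.
Qed.

(** * Integrability of a nonnegative derivative *)

(** The function [w] may be unbounded near the endpoints: its integrals over the
    compact intervals that exhaust [`]x, y[] are increments of [W], hence
    bounded by [W y - W x], and monotone convergence concludes. *)
Lemma integrable_nonneg_derivative (R : realType) (W w : R -> R) (x y : R) :
  x < y -> {within `[x, y], continuous W} ->
  (forall t, t \in `]x, y[ -> is_derive t 1 W (w t)) ->
  {in `]x, y[, continuous w} ->
  (forall t, t \in `]x, y[ -> 0 <= w t) ->
  (@lebesgue_measure R).-integrable `[x, y] (EFin \o w).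
Proof.
move=> xy cW dW cw w0; set mu := @lebesgue_measure R.
have mw : measurable_fun `]x, y[ w.
  by apply: open_continuous_measurable_fun => // t /set_mem; exact: cw.
have mw' : measurable_fun `[x, y] w.
  by apply/measurable_fun_itv_bndo_bndcP/measurable_fun_itv_obnd_cbndP.
apply/integrableP; split; first exact/measurable_EFinP.
have mabs b : measurable_fun [set` Interval b (BLeft y)] w ->
    measurable_fun [set` Interval b (BLeft y)] (fun t => `|(EFin \o w) t|)%E.
  by move=> mwb; apply: measurableT_comp => //; exact/measurable_EFinP.
rewrite -integral_itv_bndo_bndc; last first.
  by apply: mabs; apply/measurable_fun_itv_obnd_cbndP.
rewrite -integral_itv_obnd_cbnd; last exact: mabs.
have -> : (\int[mu]_(t in `]x, y[) `|(EFin \o w) t| =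
    \int[mu]_(t in `]x, y[) (w t)%:E)%E.
  by apply: eq_integral => t /set_mem tI /=; rewrite ger0_norm ?w0.
pose d (n : nat) := (y - x) / n.+3%:R.
have yx0 : 0 < y - x by rewrite subr_gt0.
have d0 n : 0 < d n by rewrite divr_gt0.
have dlt n : d n < (y - x) / 2.
  by rewrite ltr_pM2l// ltf_pV2 ?posrE// ltr_nat.
pose F (n : nat) : set R := `[x + d n, y - d n]%classic.
have Foo n : F n `<=` `]x, y[.
  by apply: subset_itv; rewrite bnd_simp ?ltrDl ?gtrBl d0.
have -> : `]x, y[%classic = \bigcup_n F n.
  apply/seteqP; split=> [t|t [n _]]; last exact: Foo.
  rewrite /= in_itv/= => /andP[xt ty].
  pose e := Num.min (t - x) (y - t).
  have e0 : 0 < e by rewrite lt_min !subr_gt0 xt ty.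
  (* any n larger than (y - x) / e makes both margins at most e *)
  exists (Num.truncn ((y - x) / e)) => //.
  set n := Num.truncn _.
  have de : d n <= e.
    rewrite ler_pdivrMr// mulrC -ler_pdivrMr// ltW//.
    by apply: lt_le_trans (truncnS_gt _) _; rewrite ler_nat -/n ltnW.
  move: de; rewrite /F/= in_itv/= le_min => /andP[dx dy].
  by apply/andP; split; lra.
have dWt t : t \in `]x, y[ -> derivable W t 1 by move=> /dW tI; case: tI.
have Wnd s t : x <= s -> s <= t -> t <= y -> W s <= W t.
  apply: (@ger0_derive1_ndecr _ W x y dWt _ cW) => r rI.
  by rewrite derive1E; have [_ ->] := dW _ rI; exact: w0.
have Fint n : (\int[mu]_(t in F n) (w t)%:E <= (W y - W x)%:E)%E.
  have nlt : x + d n < y - d n by have := dlt n; lra.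
  have sub t : t \in `](x + d n), (y - d n)[ -> t \in `]x, y[.
    by rewrite !in_itv/= => /andP[? ?]; apply/andP; have := d0 n; split; lra.
  have Lin : x + d n \in `]x, y[.
    by rewrite in_itv/=; have := d0 n; move=> ?; apply/andP; split; lra.
  have Rin : y - d n \in `]x, y[.
    by rewrite in_itv/=; have := d0 n; move=> ?; apply/andP; split; lra.
  have cWo t : t \in `]x, y[ -> {for t, continuous W}.
    move=> /dW tI.
    by apply/differentiable_continuous/derivable1_diffP; case: tI.
  rewrite (@continuous_FTC2 _ w W)//; last 3 first.
  - apply: continuous_in_subspaceT => t /set_mem /Foo; exact: cw.
  - split; first by move=> t /sub /dW tI; case: tI.
      by apply: cvg_at_right_filter; exact: cWo.
    by apply: cvg_at_left_filter; exact: cWo.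
  - by move=> t /sub /dW tI; rewrite derive1E; case: tI.
  have := d0 n; have := dlt n => dn2 dn0.
  by rewrite -EFinB lee_fin lerB// Wnd//; lra.
apply: (@le_lt_trans _ _ (W y - W x)%:E); last by rewrite ltry.
suff cvgF : (\int[mu]_(t in F n) (w t)%:E @[n --> \oo] -->
    \int[mu]_(t in \bigcup_n F n) (w t)%:E)%E.
  by apply: (cvge_to_le cvgF); exact: nearW.
apply: ge0_nondecreasing_set_cvg_integral.
- move=> m n mn; apply/subsetPset => t; rewrite /F/= !in_itv/=.
  have dmn : d n <= d m by rewrite ler_pM2l// lef_pV2 ?posrE// ler_nat !ltnS.
  by move=> /andP[? ?]; apply/andP; split; lra.
- by move=> n; exact: measurable_itv.
- move=> n; apply/measurable_EFinP; apply: measurable_funS mw => //.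
- by move=> n t /Foo /w0; rewrite lee_fin.
Qed.

(** * Integration by parts with a weight *)

Lemma integrable_continuousM (R : realType) (f w : R -> R) (x y : R) :
  {within `[x, y], continuous f} ->
  (@lebesgue_measure R).-integrable `[x, y] (EFin \o w) ->
  (@lebesgue_measure R).-integrable `[x, y] (EFin \o (f \* w)).
Proof.
move=> cf wi.
apply: (@integrableMr _ _ _ lebesgue_measure `[x, y]%classic _ f
  (EFin \o w)) => //.
  by apply: subspace_continuous_measurable_fun => //; exact: measurable_itv.
have /compact_bounded[M [_ Mf]] :=
  continuous_compact cf (@segment_compact _ x y).
by exists M; split; rewrite ?num_real// => ? ? ? ?; exact: Mf.
Qed.

(** The left-hand side is the increment of
    [D t = f t * W t - \int_x^t f * w], whose derivative is [f' t * W t]. *)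
Lemma norm_integration_by_parts_le (R : realType) (f f' W w P Q u : R -> R)
    (x y p q : R) :
  x < y -> 0 < p -> 0 < q -> p^-1 + q^-1 = 1 ->
  {within `[x, y], continuous f} ->
  (forall t, t \in `]x, y[ -> is_derive t 1 f (f' t)) ->
  {within `[x, y], continuous W} ->
  (forall t, t \in `]x, y[ -> is_derive t 1 W (w t)) ->
  {in `]x, y[, continuous w} ->
  (forall t, t \in `]x, y[ -> 0 <= w t) ->
  {within `[x, y], continuous P} ->
  (forall t, t \in `]x, y[ -> is_derive t 1 P (u t)) ->
  {within `[x, y], continuous Q} ->
  (forall t, t \in `]x, y[ -> is_derive t 1 Q (`|W t| `^ p)) ->
  (forall t, t \in `]x, y[ -> `|f' t| `^ q <= u t) ->
  `|f y * W y - f x * W x -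
    \int[@lebesgue_measure R]_(t in `[x, y]) (f t * w t)| <=
  (P y - P x) `^ q^-1 * (Q y - Q x) `^ p^-1.
Proof.
move=> xy p0 q0 pq cf df cW dW cw w0 cP dP cQ dQ f'u.
set mu := @lebesgue_measure R.
have wi := integrable_nonneg_derivative xy cW dW cw w0.
have fwi := integrable_continuousM cf wi.
pose D := (f \* W) \- (fun t => parameterized_integral mu x t (f \* w)).
have -> : f y * W y - f x * W x - \int[mu]_(t in `[x, y]) (f t * w t) =
    D y - D x.
  rewrite /D /= /parameterized_integral set_itv1 Rintegral_set1 subr0.
  by rewrite addrAC.
apply: (@norm_increment_holder _ D P Q (fun t => f' t * W t) u
  (fun t => `|W t| `^ p)) => //.
- move=> t; apply: continuousB.
    by apply: continuousM; [exact: cf|exact: cW].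
  exact: (parameterized_integral_continuous (ltW xy) fwi).
- move=> t tI; move: (tI); rewrite in_itv/= => /andP[xt ty].
  have ct g g' : is_derive t 1 g g' -> {for t, continuous g}.
    by case=> dg _; exact/differentiable_continuous/derivable1_diffP.
  have cfw : {for t, continuous (f \* w)}.
    by apply: continuousM; [exact: ct (df _ tI)|exact: cw].
  have [dI I'] := continuous_FTC1_closed ty fwi xt cfw.
  have DI : is_derive t 1
      (fun t => parameterized_integral mu x t (f \* w)) (f t * w t).
    by split; [exact: dI|rewrite -derive1E; exact: I'].
  have dfW := is_deriveM (df _ tI) (dW _ tI).
  by apply: (is_derive_eq (is_deriveB dfW DI)); rewrite /GRing.scale/=; ring.
- by move=> t tI; apply: le_trans (f'u _ tI); exact: powR_ge0.
- move=> t tI; rewrite normrM -powRrM divff ?gt_eqF// powRr1//.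
  rewrite ler_wpM2r//.
  have -> : `|f' t| = (`|f' t| `^ q) `^ q^-1.
    by rewrite -powRrM divff ?gt_eqF// powRr1.
  apply: ge0_ler_powR; rewrite ?nnegrE ?powR_ge0 ?invr_ge0 ?(ltW q0)//.
    by apply: le_trans (f'u _ tI); exact: powR_ge0.
  exact: f'u.
Qed.

(** The absolute value is there because [u `^ a] is [1] for negative [u], so
    that [powR ^~ a] is only right-continuous at 0. *)
Lemma continuous_norm_powR (R : realType) (a : R) : 0 < a ->
  continuous (fun u : R => `|u| `^ a).
Proof.
move=> a0 u; have [->|u0] := eqVneq u 0; last first.
  have cp : {for `|u|, continuous (fun v : R => v `^ a)}; last first.
    exact: (continuous_comp (@norm_continuous _ R u) cp).
  apply/differentiable_continuous/derivable1_diffP/derivable_powR.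
  by rewrite in_itv/= andbT normr_gt0.
rewrite /continuous_at normr0 powR0 ?gt_eqF//.
apply/cvgrPdist_le => e e0; near=> z.
rewrite sub0r normrN ger0_norm ?powR_ge0//.
have -> : e = (e `^ a^-1) `^ a by rewrite -powRrM mulVf ?gt_eqF// powRr1 ?ltW.
apply: ge0_ler_powR; rewrite ?nnegrE ?powR_ge0 ?(ltW a0)//.
near: z. exact: (@nbhs0_le R R _ (powR_gt0 a^-1 e0)).
Unshelve. all: by end_near. Qed.

(** Hoelder bound when [|f'| ^ q] lies below the affine function with values
    [a] and [b] at the endpoints, of mean [(a + b) / 2], and [|W| ^ p] has
    integral [h ^ (alpha * p + 1) / (alpha * p + 1)], with [h = y - x].  The
    powers of [h] add up to [1 / q + (alpha + 1 / p) = alpha + 1]. *)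
Lemma norm_integration_by_parts_affine_le (R : realType)
    (f f' W w Q : R -> R) (x y p q a b alpha : R) :
  x < y -> 0 < p -> 0 < q -> p^-1 + q^-1 = 1 -> 0 < alpha ->
  {within `[x, y], continuous f} ->
  (forall t, t \in `]x, y[ -> is_derive t 1 f (f' t)) ->
  {within `[x, y], continuous W} ->
  (forall t, t \in `]x, y[ -> is_derive t 1 W (w t)) ->
  {in `]x, y[, continuous w} ->
  (forall t, t \in `]x, y[ -> 0 <= w t) ->
  {within `[x, y], continuous Q} ->
  (forall t, t \in `]x, y[ -> is_derive t 1 Q (`|W t| `^ p)) ->
  Q y - Q x = (y - x) `^ (alpha * p + 1) / (alpha * p + 1) ->
  0 <= a -> 0 <= b ->
  (forall t, t \in `]x, y[ ->
    `|f' t| `^ q <= a + (b - a) * ((t - x) / (y - x))) ->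
  `|f y * W y - f x * W x -
    \int[@lebesgue_measure R]_(t in `[x, y]) (f t * w t)| <=
  (y - x) `^ (alpha + 1) / (alpha * p + 1) `^ p^-1 * ((a + b) / 2) `^ q^-1.
Proof.
move=> xy p0 q0 pq al0 cf df cW dW cw w0 cQ dQ QE a0 b0 f'le.
have h0 : 0 < y - x by rewrite subr_gt0.
have ap0 : 0 < alpha * p + 1 by rewrite addr_gt0// mulr_gt0.
pose P : R -> R := cst a * (id - cst x) +
  cst ((b - a) / (y - x) / 2) * ((id - cst x) * (id - cst x)).
pose u (t : R) := a + (b - a) * ((t - x) / (y - x)).
have dP (t : R) : is_derive t 1 P (u t).
  apply: is_derive_eq.
  rewrite /u /GRing.scale/= !fctE /= !(mulr0, addr0, subr0, mulr1).
  by field; rewrite gt_eqF.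
have cP : {within `[x, y], continuous P}.
  apply: continuous_subspaceT => t.
  by apply/differentiable_continuous/derivable1_diffP; case: (dP t).
have := norm_integration_by_parts_le xy p0 q0 pq cf df cW dW cw w0 cP
  (fun t _ => dP t) cQ dQ f'le.
move=> /le_trans; apply.
have -> : P y - P x = (y - x) * ((a + b) / 2).
  by rewrite /P !fctE /=; field; rewrite gt_eqF.
have : 0 <= (a + b) / 2 by rewrite divr_ge0// addr_ge0.
set c := (a + b) / 2 => c0.
rewrite QE powRM ?(ltW h0)// powRM ?powR_ge0 ?invr_ge0 ?(ltW ap0)//.
have -> : (alpha * p + 1)^-1 `^ p^-1 = ((alpha * p + 1) `^ p^-1)^-1.
  by rewrite -powR_inv1 ?(ltW ap0)// -powRrM mulN1r powRN.
rewrite -powRrM.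
have -> : (alpha * p + 1) * p^-1 = alpha + p^-1 by field; rewrite gt_eqF.
have -> : alpha + 1 = q^-1 + (alpha + p^-1) by rewrite -pq; ring.
have -> : (y - x) `^ (q^-1 + (alpha + p^-1)) =
    (y - x) `^ q^-1 * (y - x) `^ (alpha + p^-1).
  by apply: powRD; rewrite (gt_eqF h0) implybT.
by rewrite le_eqVlt; apply/orP; left; apply/eqP; ring.
Qed.

(** * Power weights *)

Lemma within_continuous_powR_subl (R : realType) (a x y : R) : 0 < a ->
  {within `[x, y], continuous (fun t => (t - x) `^ a)}.
Proof.
move=> a0; apply: (@subspace_eq_continuous _ _ _ (fun t => `|t - x| `^ a)).
  move=> t /set_mem/=; rewrite in_itv/= => /andP[xt _].
  by rewrite ger0_norm ?subr_ge0.
apply: continuous_subspaceT => t.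
have cs : {for t, continuous (fun t => t - x)}.
  by apply: continuousB; [exact: cvg_id|exact: cst_continuous].
exact: (continuous_comp cs (@continuous_norm_powR _ _ a0 _)).
Qed.

Lemma within_continuous_powR_subr (R : realType) (a x y : R) : 0 < a ->
  {within `[x, y], continuous (fun t => (y - t) `^ a)}.
Proof.
move=> a0; apply: (@subspace_eq_continuous _ _ _ (fun t => `|y - t| `^ a)).
  move=> t /set_mem/=; rewrite in_itv/= => /andP[_ ty].
  by rewrite ger0_norm ?subr_ge0.
apply: continuous_subspaceT => t.
have cs : {for t, continuous (fun t => y - t)}.
  by apply: continuousB; [exact: cst_continuous|exact: cvg_id].
exact: (continuous_comp cs (@continuous_norm_powR _ _ a0 _)).
Qed.

Lemma is_derive_powR_subl (R : realType) (a x t : R) : x < t ->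
  is_derive t 1 (fun t => (t - x) `^ a) (a * (t - x) `^ (a - 1)).
Proof.
rewrite -subr_gt0 => xt.
have d1 : is_derive t 1 (id - cst x : R -> R) (1 : R).
  by apply: is_derive_eq; rewrite subr0.
have := @is_derive1_comp R (@powR R ^~ a) (id - cst x) t _ _
  (is_derive1_powR a xt) d1.
by rewrite mulr1.
Qed.

Lemma is_derive_powR_subr (R : realType) (a y t : R) : t < y ->
  is_derive t 1 (fun t => (y - t) `^ a) (- (a * (y - t) `^ (a - 1))).
Proof.
rewrite -subr_gt0 => ty.
have d1 : is_derive t 1 (cst y - id : R -> R) (- 1 : R).
  by apply: is_derive_eq; rewrite sub0r.
have := @is_derive1_comp R (@powR R ^~ a) (cst y - id) t _ _
  (is_derive1_powR a ty) d1.
by rewrite mulrN1.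
Qed.

(** For [k != 0] the integrability of [g] is recovered from that of [k * g]. *)
Lemma RintegralZl_neq0 (R : realType) (g : R -> R) (k x y : R) : k != 0 ->
  (@lebesgue_measure R).-integrable `[x, y] (EFin \o (fun t => k * g t)) ->
  \int[@lebesgue_measure R]_(t in `[x, y]) (k * g t) =
  k * \int[@lebesgue_measure R]_(t in `[x, y]) g t.
Proof.
move=> k0 kgi; apply: RintegralZl => //.
have mI : measurable (`[x, y]%classic : set (measurableTypeR R)) by [].
have := integrableZl mI k^-1 kgi.
by apply: eq_integrable => // t _ /=; rewrite -EFinM mulKf.
Qed.

(** Integration by parts against [W t = (t - x) ^ alpha], which vanishes at
    [x]. *)
Lemma norm_powR_subl_by_parts_le (R : realType) (f f' : R -> R)
    (x y p q a b alpha : R) :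
  x < y -> 0 < p -> 0 < q -> p^-1 + q^-1 = 1 -> 0 < alpha ->
  {within `[x, y], continuous f} ->
  (forall t, t \in `]x, y[ -> is_derive t 1 f (f' t)) ->
  0 <= a -> 0 <= b ->
  (forall t, t \in `]x, y[ ->
    `|f' t| `^ q <= a + (b - a) * ((t - x) / (y - x))) ->
  `|f y * (y - x) `^ alpha - alpha *
    \int[@lebesgue_measure R]_(t in `[x, y]) (f t * (t - x) `^ (alpha - 1))| <=
  (y - x) `^ (alpha + 1) / (alpha * p + 1) `^ p^-1 * ((a + b) / 2) `^ q^-1.
Proof.
move=> xy p0 q0 pq al0 cf df a0 b0 f'le.
have ap0 : 0 < alpha * p + 1 by rewrite addr_gt0// mulr_gt0.
pose W (t : R) := (t - x) `^ alpha.
pose w (t : R) := alpha * (t - x) `^ (alpha - 1).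
pose Q : R -> R := (alpha * p + 1)^-1 \*: (fun t => (t - x) `^ (alpha * p + 1)).
have cW : {within `[x, y], continuous W} by exact: within_continuous_powR_subl.
have dW t : t \in `]x, y[ -> is_derive t 1 W (w t).
  by rewrite in_itv/= => /andP[xt _]; exact: is_derive_powR_subl.
have cw : {in `]x, y[, continuous w}.
  move=> t; rewrite in_itv/= => /andP[xt _].
  have : {for t, continuous (fun t => (t - x) `^ (alpha - 1))}; last first.
    by apply: continuousM; exact: cst_continuous.
  apply/differentiable_continuous/derivable1_diffP.
  by case: (is_derive_powR_subl (alpha - 1) xt).
have w0 t : t \in `]x, y[ -> 0 <= w t.
  by move=> _; rewrite mulr_ge0 ?powR_ge0// ltW.
have cQ : {within `[x, y], continuous Q}.
  move=> t; apply: (@continuousM _ _ (cst (alpha * p + 1)^-1)).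
    exact: cst_continuous.
  exact: within_continuous_powR_subl.
have dQ t : t \in `]x, y[ -> is_derive t 1 Q (`|W t| `^ p).
  rewrite in_itv/= => /andP[xt _].
  have d1 := is_derive_powR_subl (alpha * p + 1) xt.
  apply: (is_derive_eq (is_deriveZ (alpha * p + 1)^-1 d1)).
  rewrite /GRing.scale/= mulKf ?gt_eqF// ger0_norm ?powR_ge0//.
  by rewrite -powRrM addrK.
have QE : Q y - Q x = (y - x) `^ (alpha * p + 1) / (alpha * p + 1).
  by rewrite /Q /= /GRing.scale/= subrr powR0 ?gt_eqF// mulr0 subr0 mulrC.
have := norm_integration_by_parts_affine_le xy p0 q0 pq al0 cf df cW dW cw w0
  cQ dQ QE a0 b0 f'le.
rewrite /W subrr powR0 ?gt_eqF// mulr0 subr0.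
have fwi := integrable_continuousM cf
  (integrable_nonneg_derivative xy cW dW cw w0).
have fwE : (fun t => alpha * (f t * (t - x) `^ (alpha - 1))) = f \* w.
  by apply/funext => t; rewrite /w /= mulrCA.
by rewrite -RintegralZl_neq0 ?gt_eqF// fwE.
Qed.

(** Integration by parts against [W t = - (y - t) ^ alpha], which is again
    increasing and vanishes at [y]. *)
Lemma norm_powR_subr_by_parts_le (R : realType) (f f' : R -> R)
    (x y p q a b alpha : R) :
  x < y -> 0 < p -> 0 < q -> p^-1 + q^-1 = 1 -> 0 < alpha ->
  {within `[x, y], continuous f} ->
  (forall t, t \in `]x, y[ -> is_derive t 1 f (f' t)) ->
  0 <= a -> 0 <= b ->
  (forall t, t \in `]x, y[ ->
    `|f' t| `^ q <= a + (b - a) * ((t - x) / (y - x))) ->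
  `|f x * (y - x) `^ alpha - alpha *
    \int[@lebesgue_measure R]_(t in `[x, y]) (f t * (y - t) `^ (alpha - 1))| <=
  (y - x) `^ (alpha + 1) / (alpha * p + 1) `^ p^-1 * ((a + b) / 2) `^ q^-1.
Proof.
move=> xy p0 q0 pq al0 cf df a0 b0 f'le.
have ap0 : 0 < alpha * p + 1 by rewrite addr_gt0// mulr_gt0.
pose W : R -> R := \- (fun t => (y - t) `^ alpha).
pose w (t : R) := alpha * (y - t) `^ (alpha - 1).
pose Q : R -> R :=
  (- (alpha * p + 1)^-1) \*: (fun t => (y - t) `^ (alpha * p + 1)).
have cW : {within `[x, y], continuous W}.
  by move=> t; apply: continuousN; exact: within_continuous_powR_subr.
have dW t : t \in `]x, y[ -> is_derive t 1 W (w t).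
  rewrite in_itv/= => /andP[_ ty].
  have d1 := is_derive_powR_subr alpha ty.
  by apply: (is_derive_eq (is_deriveN d1)); rewrite opprK.
have cw : {in `]x, y[, continuous w}.
  move=> t; rewrite in_itv/= => /andP[_ ty].
  have : {for t, continuous (fun t => (y - t) `^ (alpha - 1))}; last first.
    by apply: continuousM; exact: cst_continuous.
  apply/differentiable_continuous/derivable1_diffP.
  by case: (is_derive_powR_subr (alpha - 1) ty).
have w0 t : t \in `]x, y[ -> 0 <= w t.
  by move=> _; rewrite mulr_ge0 ?powR_ge0// ltW.
have cQ : {within `[x, y], continuous Q}.
  move=> t; apply: (@continuousM _ _ (cst (- (alpha * p + 1)^-1))).
    exact: cst_continuous.
  exact: within_continuous_powR_subr.
have dQ t : t \in `]x, y[ -> is_derive t 1 Q (`|W t| `^ p).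
  rewrite in_itv/= => /andP[_ ty].
  have d1 := is_derive_powR_subr (alpha * p + 1) ty.
  apply: (is_derive_eq (is_deriveZ (- (alpha * p + 1)^-1) d1)).
  rewrite /GRing.scale/= mulrNN mulKf ?gt_eqF// normrN ger0_norm ?powR_ge0//.
  by rewrite -powRrM addrK.
have QE : Q y - Q x = (y - x) `^ (alpha * p + 1) / (alpha * p + 1).
  rewrite /Q /= /GRing.scale/= subrr powR0 ?gt_eqF// mulr0 sub0r.
  by rewrite mulNr opprK mulrC.
have := norm_integration_by_parts_affine_le xy p0 q0 pq al0 cf df cW dW cw w0
  cQ dQ QE a0 b0 f'le.
rewrite /W /= subrr powR0 ?gt_eqF// oppr0 mulr0 sub0r mulrN opprK.
have fwi := integrable_continuousM cf
  (integrable_nonneg_derivative xy cW dW cw w0).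
have fwE : (fun t => alpha * (f t * (y - t) `^ (alpha - 1))) = f \* w.
  by apply/funext => t; rewrite /w /= mulrCA.
by rewrite -RintegralZl_neq0 ?gt_eqF// fwE.
Qed.

(** * Convexity and the Gamma function *)

Lemma convex_function_le_chord (R : realType) (g : R -> R) (x y t : R) :
  x < y -> convex_function (`[x, y]%classic : set R) g -> t \in `[x, y] ->
  g t <= g x + (g y - g x) * ((t - x) / (y - x)).
Proof.
move=> xy gconv; rewrite in_itv/= => /andP[xt ty].
have h0 : 0 < y - x by rewrite subr_gt0.
pose k := (t - x) / (y - x).
have k0 : 0 <= k by rewrite divr_ge0 ?subr_ge0// ltW.
have k1 : k <= 1 by rewrite ler_pdivrMr// mul1r lerB.
have xI : x \in (`[x, y]%classic : set R) by rewrite inE/= in_itv/= lexx ltW.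
have yI : y \in (`[x, y]%classic : set R) by rewrite inE/= in_itv/= lexx ltW.
have := gconv (Itv01 k0 k1) y x yI xI.
have -> : conv (Itv01 k0 k1) (y : convex_lmodType R^o) x = t.
  transitivity (k * y + (1 - k) * x); first by [].
  by rewrite /k; field; rewrite gt_eqF.
move=> /le_trans; apply; rewrite -/k.
have -> : conv (Itv01 k0 k1) (g y : R^o) (g x) = k * g y + (1 - k) * g x by [].
by lra.
Qed.

(** Euler's integral is bounded below by its part over [`[1, 2]].  It is finite
    because the integrand is at most [t ^ (a - 1)] on [`]0, 1]] and, as
    [a <= 1], at most [exp (- t)] on [`]1, +oo[]. *)
Lemma Gamma_gt0 (R : realType) (a : R) : 0 < a <= 1 -> 0 < Gamma a.
Proof.
move=> /andP[a0 a1]; set mu := @lebesgue_measure R.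
pose g (t : R) := t `^ (a - 1) * expR (- t).
have g0 t : (0 <= (g t)%:E)%E by rewrite lee_fin mulr_ge0 ?powR_ge0 ?expR_ge0.
have mpow : measurable_fun setT (fun t : R => t `^ (a - 1)).
  exact: measurable_powR.
have mexp : measurable_fun setT (fun t : R => expR (- t)).
  by apply: measurableT_comp => //; exact: measurable_funN.
have mg : measurable_fun setT (EFin \o g).
  by apply/measurable_EFinP; exact: measurable_funM.
have mgD D : measurable_fun D (EFin \o g) by exact: measurable_funTS.
rewrite /Gamma /Rintegral; apply: fine_gt0; apply/andP; split.
  apply: (@lt_le_trans _ _
    (\int[mu]_(t in `[1%R, 2%R]) (cst (expR (- 2) / 2)%:E t))%E).
    rewrite integral_cst//= /mu lebesgue_measure_itv/= lte_fin ltr1n.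
    rewrite -EFinB -EFinM lte_fin.
    by rewrite mulr_gt0 ?divr_gt0 ?expR_gt0//; lra.
  apply: (@le_trans _ _ (\int[mu]_(t in `[1%R, 2%R]) (g t)%:E)%E); last first.
    apply: ge0_subset_integral => //; first exact: mgD.
    move=> t/=; rewrite !in_itv/= andbT => /andP[t1 _].
    exact: lt_le_trans t1.
  apply: ge0_le_integral => //.
  - by move=> t _; rewrite lee_fin divr_ge0 ?expR_ge0.
  - exact: mgD.
  move=> t /=; rewrite in_itv/= => /andP[t1 t2]; rewrite lee_fin /g mulrC.
  have t0 : 0 < t by exact: lt_le_trans t1.
  apply: ler_pM; rewrite ?invr_ge0 ?expR_ge0//.
    apply: (@le_trans _ _ (t `^ (-1))).
      by rewrite powR_inv1 ?(ltW t0)// lef_pV2 ?posrE.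
    by apply: ler_powR => //; lra.
  by rewrite ler_expR lerN2.
have U : `]0, +oo[%classic = `]0, 1] `|` `]1, +oo[ :> set R.
  by rewrite -itv_bndbnd_setU ?bnd_simp.
rewrite U ge0_integral_setU//=; last 3 first.
- exact: mgD.
- by move=> t _; exact: g0.
- by apply/disj_setPS => t [/=]; rewrite !in_itv/= => /andP[_ t1];
    rewrite andbT ltNge t1.
apply: lte_add_pinfty.
  pose W : R -> R := a^-1 \*: (fun t => (t - 0) `^ a).
  have Wi : mu.-integrable `[0, 1] (EFin \o (fun t => t `^ (a - 1))).
    apply: (@integrable_nonneg_derivative _ W) => //.
    - move=> t; apply: (@continuousM _ _ (cst a^-1)).
        exact: cst_continuous.
      exact: within_continuous_powR_subl.
    - move=> t; rewrite in_itv/= => /andP[t0 _].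
      apply: (is_derive_eq (is_deriveZ a^-1 (is_derive_powR_subl a t0))).
      by rewrite /GRing.scale/= mulKf ?gt_eqF// subr0.
    - move=> t; rewrite in_itv/= => /andP[t0 _].
      apply/differentiable_continuous/derivable1_diffP/derivable_powR.
      by rewrite in_itv/= t0.
    - by move=> t _; exact: powR_ge0.
  have /integrableP[_ Wlt] :
      mu.-integrable `]0, 1] (EFin \o (fun t => t `^ (a - 1))).
    by apply: integrableS Wi => //; exact: subset_itv_oc_cc.
  apply: le_lt_trans Wlt; apply: ge0_le_integral => //.
  - by move=> t _; exact: g0.
  - exact: mgD.
  - apply: measurableT_comp => //; apply/measurable_EFinP.
    exact: measurable_funTS.
  move=> t /=; rewrite in_itv/= => /andP[t0 _].
  rewrite lee_fin ger0_norm ?powR_ge0// ler_piMr ?powR_ge0//.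
  by rewrite -expR0 ler_expR oppr_le0 ltW.
pose F : R -> R := \- (fun t => expR (- t)).
have dexp (t : R) : is_derive t 1 (fun t : R => expR (- t)) (expR (- t) * -1).
  exact: (@is_derive1_comp R expR -%R).
have dF (t : R) : is_derive t 1 F (expR (- t)).
  by apply: (is_derive_eq (is_deriveN (dexp t))); rewrite mulrN1 opprK.
have cF (t : R) : {for t, continuous F}.
  by apply/differentiable_continuous/derivable1_diffP; case: (dF t).
have E1 : (\int[mu]_(t in `[1%R, +oo[) (expR (- t))%:E = 0%:E - (F 1)%:E)%E.
  apply: ge0_continuous_FTC2y.
  - by move=> t _; exact: expR_ge0.
  - apply: continuous_subspaceT => t.
    by apply/differentiable_continuous/derivable1_diffP; case: (dexp t).
  - rewrite -[X in _ --> X]oppr0; apply: cvgN; exact: cvgr_expR.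
  - by move=> t _; case: (dF t).
  - by apply: cvg_at_right_filter; exact: cF.
  - by move=> t _; rewrite derive1E; case: (dF t).
apply: (@le_lt_trans _ _ (0%:E - (F 1)%:E)%E); last by rewrite -EFinB ltry.
rewrite -E1 -integral_itv_obnd_cbnd; last first.
  by apply/measurable_EFinP; exact: measurable_funTS.
apply: ge0_le_integral => //.
- by move=> t _; exact: g0.
- exact: mgD.
- by apply/measurable_EFinP; exact: measurable_funTS.
move=> t /=; rewrite in_itv/= andbT => t1; rewrite lee_fin ler_piMl ?expR_ge0//.
by rewrite -[X in _ <= X](powRr0 t); apply: ler_powR; [exact: ltW|lra].
Qed.

(** * The trapezoid-midpoint inequality for Atangana-Baleanu integrals *)

Theorem theorem2p2 (R : realType) (theta1 theta2 alpha p q : R)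
    (B f df : R -> R)
    (htheta : theta1 < theta2)
    (hf : is_derivative_itv f df theta1 theta2)
    (hL1 : (@lebesgue_measure R).-integrable `[theta1, theta2] (EFin \o df))
    (hconvex : convex_function (`[theta1, theta2]%classic : set R)
                 (fun x : R => `|df x| `^ q))
    (hpq : p^-1 + q^-1 = 1)
    (hq : 1 < q)
    (halpha : 0 <= alpha <= 1)
    (halpha0 : alpha != 0) (* Gamma has a pole at 0 *)
    (hB : normalization_function B) :
  let L := theta2 - theta1 in
  let m := (theta1 + theta2) / 2 in
  `| (2 * L `^ alpha + (1 - alpha) * 2 `^ (alpha + 1) * Gamma alpha)
       / L `^ (alpha + 1)
       * (f theta1 + f theta2 + 2 * f m)
     - 2 `^ (alpha + 1) * B alpha * Gamma alpha / L `^ (alpha + 1)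
       * (AB_right_integral B m alpha f theta1
          + AB_left_integral B theta1 alpha f m
          + AB_left_integral B m alpha f theta2
          + AB_right_integral B theta2 alpha f m) |
  <= 2 / (alpha * p + 1) `^ p^-1
     * (((3 * `|df theta1| `^ q + `|df theta2| `^ q) / 4) `^ q^-1
        + ((3 * `|df theta2| `^ q + `|df theta1| `^ q) / 4) `^ q^-1).
Proof.
cbv zeta; set L := theta2 - theta1; set m := (theta1 + theta2) / 2.
have [p0 q0] : 0 < p /\ 0 < q.
  have q0 : 0 < q by exact: lt_trans hq.
  split=> //; rewrite -invr_gt0 (_ : p^-1 = 1 - q^-1); last by lra.
  by rewrite subr_gt0 invf_lt1.
have /andP[al_ge0 al1] := halpha.
have al0 : 0 < alpha by rewrite lt_neqAle eq_sym halpha0.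
have [_ _ /(_ _ halpha) B0] := hB.
have G0 : 0 < Gamma alpha by apply: Gamma_gt0; rewrite al0.
have [[fd fc1 fc2] fE] := hf.
have cf : {within `[theta1, theta2], continuous f}.
  exact: derivable_oo_LRcontinuous_within.
have fD t : t \in `]theta1, theta2[ -> is_derive t 1 f (df t).
  by move=> tI; rewrite -fE// derive1E; exact/derivableP/fd.
set c1 := `|df theta1| `^ q; set c2 := `|df theta2| `^ q.
have c10 : 0 <= c1 by exact: powR_ge0.
have c20 : 0 <= c2 by exact: powR_ge0.
have chord t : t \in `]theta1, theta2[ ->
    `|df t| `^ q <= c1 + (c2 - c1) * ((t - theta1) / L).
  move=> tI; apply: (@convex_function_le_chord _ (fun x => `|df x| `^ q)) => //.
  exact: subset_itv_oo_cc tI.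
have L0 : 0 < L by rewrite subr_gt0.
pose h := L / 2.
have h0 : 0 < h by rewrite divr_gt0.
have LE : L = 2 * h by rewrite /h mulrC divfK.
have t1m : theta1 < m by rewrite /m; lra.
have mt2 : m < theta2 by rewrite /m; lra.
have mt1E : m - theta1 = h by rewrite /m /h /L; field.
have t2mE : theta2 - m = h by rewrite /m /h /L; field.
have cfl : {within `[theta1, m], continuous f}.
  by apply: continuous_subspaceW cf; apply: subset_itvl; rewrite bnd_simp ltW.
have cfr : {within `[m, theta2], continuous f}.
  by apply: continuous_subspaceW cf; apply: subset_itvr; rewrite bnd_simp ltW.
have subl t : t \in `]theta1, m[ -> t \in `]theta1, theta2[.
  by rewrite !in_itv/= => /andP[-> tm]; exact: lt_trans mt2.
have subr t : t \in `]m, theta2[ -> t \in `]theta1, theta2[.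
  by rewrite !in_itv/= => /andP[mt ->]; rewrite (lt_trans t1m).
have mid0 : 0 <= (c1 + c2) / 2 by rewrite divr_ge0// addr_ge0.
(* the chord over the whole interval, restricted to each half *)
have chordl t : t \in `]theta1, m[ ->
    `|df t| `^ q <= c1 + ((c1 + c2) / 2 - c1) * ((t - theta1) / (m - theta1)).
  move=> /subl /chord /le_trans; apply; rewrite mt1E LE.
  by rewrite le_eqVlt; apply/orP; left; apply/eqP; field; rewrite gt_eqF.
have chordr t : t \in `]m, theta2[ ->
    `|df t| `^ q <=
      (c1 + c2) / 2 + (c2 - (c1 + c2) / 2) * ((t - m) / (theta2 - m)).
  move=> /subr /chord /le_trans; apply; rewrite t2mE LE.
  rewrite (_ : t - theta1 = (t - m) + h); last by rewrite -mt1E; ring.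
  by rewrite le_eqVlt; apply/orP; left; apply/eqP; field; rewrite gt_eqF.
have fDl t (tI : t \in `]theta1, m[) := fD _ (subl _ tI).
have fDr t (tI : t \in `]m, theta2[) := fD _ (subr _ tI).
have := norm_powR_subl_by_parts_le t1m p0 q0 hpq al0 cfl fDl c10 mid0 chordl.
have := norm_powR_subr_by_parts_le t1m p0 q0 hpq al0 cfl fDl c10 mid0 chordl.
have := norm_powR_subr_by_parts_le mt2 p0 q0 hpq al0 cfr fDr mid0 c20 chordr.
have := norm_powR_subl_by_parts_le mt2 p0 q0 hpq al0 cfr fDr mid0 c20 chordr.
rewrite /AB_left_integral /AB_right_integral mt1E t2mE.
set I4 :=
  \int[@lebesgue_measure R]_(y in `[m, theta2]) (f y * (y - m) `^ (alpha - 1)).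
set I3 :=
  \int[@lebesgue_measure R]_(y in `[m, theta2]) (f y * (theta2 - y) `^ (alpha - 1)).
set I2 :=
  \int[@lebesgue_measure R]_(y in `[theta1, m]) (f y * (m - y) `^ (alpha - 1)).
set I1 :=
  \int[@lebesgue_measure R]_(y in `[theta1, m]) (f y * (y - theta1) `^ (alpha - 1)).
rewrite (_ : (c1 + (c1 + c2) / 2) / 2 = (3 * c1 + c2) / 4); last by field.
rewrite (_ : ((c1 + c2) / 2 + c2) / 2 = (3 * c2 + c1) / 4); last by field.
set K1 := ((3 * c1 + c2) / 4) `^ q^-1; set K2 := ((3 * c2 + c1) / 4) `^ q^-1.
set S := (alpha * p + 1) `^ p^-1.
have powSr z : 0 < z -> z `^ (alpha + 1) = z `^ alpha * z.
  by move=> z0; rewrite powRD ?powRr1 ?(ltW z0)// (gt_eqF z0) implybT.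
rewrite LE !powSr ?mulr_gt0// powRM ?(ltW h0)//.
have : 0 < h `^ alpha by exact: powR_gt0.
have : 0 < (2 : R) `^ alpha by exact: powR_gt0.
set H := h `^ alpha; set T := 2 `^ alpha => T0 H0 le4 le3 le2 le1.
have Hh0 : 0 < H * h by rewrite mulr_gt0.
(* the local terms cancel, and so do B alpha and Gamma alpha *)
have -> : (2 * (T * H) + (1 - alpha) * (T * 2) * Gamma alpha) /
      (T * H * (2 * h)) * (f theta1 + f theta2 + 2 * f m) -
    T * 2 * B alpha * Gamma alpha / (T * H * (2 * h)) *
     ((1 - alpha) / B alpha * f theta1 + alpha / (B alpha * Gamma alpha) * I1 +
      ((1 - alpha) / B alpha * f m + alpha / (B alpha * Gamma alpha) * I2) +
      ((1 - alpha) / B alpha * f theta2 + alpha / (B alpha * Gamma alpha) * I3) +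
      ((1 - alpha) / B alpha * f m + alpha / (B alpha * Gamma alpha) * I4)) =
    ((f m * H - alpha * I1) + (f theta1 * H - alpha * I2) +
     ((f m * H - alpha * I3) + (f theta2 * H - alpha * I4))) / (H * h).
  by field; rewrite !gt_eqF.
rewrite normrM [`|(H * h)^-1|]gtr0_norm ?invr_gt0// ler_pdivrMr//.
apply: le_trans (ler_normD _ _) _.
have -> : 2 / S * (K1 + K2) * (H * h) =
  (H * h / S * K1 + H * h / S * K1) + (H * h / S * K2 + H * h / S * K2) by ring.
exact: lerD (le_trans (ler_normD _ _) (lerD le1 le2))
  (le_trans (ler_normD _ _) (lerD le3 le4)).
Qed.
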